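(* Let $\mathscr{D}$ be the filtered semiring of max-plus polynomials on the barcode space. For every $F\in\mathscr{D}$ and every $p\ge1$ there exists a constant $C$ such that $$|F(\mathscr{B}_1)-F(\mathscr{B}_2)|\le C\,\mathrm{d}_p(\mathscr{B}_1,\mathscr{B}_2)$$ for every pair of barcodes $\mathscr{B}_1$ and $\mathscr{B}_2$, where $\mathrm{d}_p$ is the $p$-th Wasserstein distance.
   Context: Barcodes: an interval is encoded as $(x,d)$, with left endpoint $x\ge0$ and length $d\ge0$. $B_n$ is the orbit space of $([0,\infty)\times[0,\infty))^n$ under the action of $S_n$ permuting the $n$ pairs. The barcode space is $B=\coprod_nB_n/_\sim$, where $\sim$ is generated by $\{(x_1,d_1),\dots,(x_n,d_n)\}\sim\{(x_1,d_1),\dots,(x_{n-1},d_{n-1})\}$ whenever $d_n=0$. Wasserstein distance: for intervals put $\mathrm{d}_\infty((x_1,d_1),(x_2,d_2))=\max(|x_1-x_2|,|d_1-d_2+x_1-x_2|)$, and let the distance from an interval to the set $\Delta$ of zero-length intervals be $\mathrm{d}_\infty((x,d),\Delta)=d/2$. For barcodes $\mathscr{B}_1=\{I_\alpha\}_{\alpha\in A}$, $\mathscr{B}_2=\{J_\beta\}_{\beta\in B}$ ($A,B$ finite index sets), a real $p\ge1$ and a bijection $\theta:A'\to B'$ with $A'\subseteq A$, $B'\subseteq B$, let $P_p(\theta)=\sum_{a\in A'}\mathrm{d}_\infty(I_a,J_{\theta(a)})^p+\sum_{a\in A\setminus A'}\mathrm{d}_\infty(I_a,\Delta)^p+\sum_{b\in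 B\setminus B'}\mathrm{d}_\infty(J_b,\Delta)^p$. Then $\mathrm{d}_p(\mathscr{B}_1,\mathscr{B}_2)=(\min_\theta P_p(\theta))^{1/p}$ over all such $\theta$. The semiring $\mathscr{D}$: a max-plus polynomial is a function of the form $\max_{1\le i\le m}(a_i+c_1^iz_1+\cdots+c_r^iz_r)$ with $m\ge1$, $a_i\in\mathbb{R}$ and nonnegative integers $c_j^i$; its degree is $\max_i(c_1^i+\cdots+c_r^i)$. $D_n$ is the semiring (operations: pointwise maximum and pointwise sum) of max-plus polynomials $p(x_1,d_1,\dots,x_n,d_n)$, regarded as functions on $([0,\infty)\times[0,\infty))^n$, such that for every $j$ the restriction of $p$ to $\{d_j=0\}$ is independent of $x_j$. $D_n^{S_n}$ is the set of elements of $D_n$ invariant under permutation of the pairs $(x_i,d_i)$, and ${}_kD_n^{S_n}$ the subset of elements of degree at most $k$. $\mathscr{D}^k$ is the inverse limit over $n$ of the maps ${}_kD_n^{S_n}\to{}_kD_{n-1}^{S_{n-1}}$, $f\mapsto f(x_1,d_1,\dots,x_{n-1},d_{n-1},0,0)$, and $\mathscr{D}=\bigcup_{k\ge1}\mathscr{D}^k$. An element $F=(f_n)_n$ of $\mathscr{D}$ is a function on $B$: $F(\mathscr{B})=f_n(\mathscr{B})$ when $\mathscr{B}$ is represented by $n$ intervals. *)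

(* Defs.v *)
From HB Require Import structures.
From Stdlib Require Import Relation_Operators.
From mathcomp Require Import all_boot all_order all_algebra generic_quotient.
From mathcomp Require Import perm interval_inference.
From mathcomp Require Import boolp classical_sets reals exp.
From mathcomp Require Import lra.

Set Implicit Arguments.
Unset Strict Implicit.
Unset Printing Implicit Defensive.

Import Order.TTheory GRing.Theory Num.Theory.

Local Open Scope classical_set_scope.
Local Open Scope ring_scope.
Local Open Scope quotient_scope.

(** * Bars and barcodes *)

(* A bar is a pair (left endpoint, length); its right endpoint is the sum of
   the two components. *)
Definition bar (R : realType) : Type := ({nonneg R} * {nonneg R})%type.

HB.instance Definition _ (R : realType) := Choice.on (bar R).

Definition bar_left (R : realType) (I : bar R) : R := I.1%:num.
Definition bar_len (R : realType) (I : bar R) : R := I.2%:num.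

(* [seq (bar R)] plays the role of the disjoint union over n of the n-th powers
   of [bar R].  Its quotient by the equivalence relation generated by the two
   steps below is both the passage to S_n-orbits and the removal of bars of
   length 0. *)
Variant bar_step (R : realType) : seq (bar R) -> seq (bar R) -> Prop :=
| BarPerm s t of perm_eq s t : bar_step s t
| BarDrop s I of bar_len I = 0 : bar_step (rcons s I) s.

Definition bar_equiv (R : realType) : rel (seq (bar R)) :=
  fun s t => `[< clos_refl_sym_trans _ (@bar_step R) s t >].

Lemma bar_equiv_refl (R : realType) : reflexive (@bar_equiv R).
Proof. by move=> s; apply/asboolP/rst_refl. Qed.

Lemma bar_equiv_sym (R : realType) : symmetric (@bar_equiv R).
Proof.
by move=> s t; apply/idP/idP => /asboolP h; apply/asboolP/rst_sym.
Qed.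

Lemma bar_equiv_trans (R : realType) : transitive (@bar_equiv R).
Proof.
move=> t s u /asboolP st /asboolP tu; apply/asboolP; exact: rst_trans tu.
Qed.

Canonical bar_equiv_rel (R : realType) := EquivRel (@bar_equiv R)
  (@bar_equiv_refl R) (@bar_equiv_sym R) (@bar_equiv_trans R).

Definition barcode (R : realType) : Type := {eq_quot (@bar_equiv_rel R)}.

HB.instance Definition _ (R : realType) := Quotient.on (barcode R).

(** * Wasserstein distances *)

Definition dist_bar (R : realType) (I J : bar R) : R :=
  Num.max `|bar_left I - bar_left J|
          `|bar_len I - bar_len J + bar_left I - bar_left J|.

Definition dist_diag (R : realType) (I : bar R) : R := bar_len I / 2.

(* A bijection between a subset A' of A and a subset B' of B is encoded as a
   partial function from A to B which is injective where it is defined: A' is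
   its domain of definition and B' its range. *)
Definition matching (A B : finType) (theta : {ffun A -> option B}) : bool :=
  [forall a, forall a', (theta a == theta a') ==>
    ((theta a == None) || (a == a'))].

Definition matching_cost (R : realType) (p : R) (A B : finType)
    (I : A -> bar R) (J : B -> bar R) (theta : {ffun A -> option B}) : R :=
  (\sum_a \sum_(b | theta a == Some b) dist_bar (I a) (J b) `^ p)
  + (\sum_(a | theta a == None) dist_diag (I a) `^ p)
  + (\sum_(b | [forall a, theta a != Some b]) dist_diag (J b) `^ p).

(* The minimum is over a nonempty finite set, as the nowhere defined function
   is a matching; its cost is the initial value of the iterated minimum. *)
Definition wasserstein_fam (R : realType) (p : R) (A B : finType)
    (I : A -> bar R) (J : B -> bar R) : R :=
  (\big[Num.min/matching_cost p I J [ffun=> None]]_(theta | matching theta)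
     matching_cost p I J theta) `^ p^-1.

(* The value does not depend on the representatives: see [wassersteinE]. *)
Definition wasserstein (R : realType) (p : R) (b1 b2 : barcode R) : R :=
  wasserstein_fam p (tnth (in_tuple (repr b1))) (tnth (in_tuple (repr b2))).

(** * Max-plus polynomials *)

(* Formal max-plus polynomials with variables indexed by V; the index type
   'I_(_.+1) makes the set of monomials nonempty. *)
Record maxplus (R : realType) (V : finType) := MaxPlus {
  mp_size : nat;
  mp_coef : 'I_mp_size.+1 -> R;
  mp_expo : 'I_mp_size.+1 -> V -> nat }.

Arguments mp_coef {R V} P i : rename.
Arguments mp_expo {R V} P i v : rename.

Definition mp_monomial (R : realType) (V : finType) (P : maxplus R V)
    (z : V -> R) (i : 'I_(mp_size P).+1) : R :=
  mp_coef P i + \sum_v (mp_expo P i v)%:R * z v.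

Arguments mp_monomial {R V} P z i.

Definition mp_eval (R : realType) (V : finType) (P : maxplus R V)
    (z : V -> R) : R :=
  \big[Num.max/mp_monomial P z ord0]_i mp_monomial P z i.

Definition mp_degree (R : realType) (V : finType) (P : maxplus R V) : nat :=
  (\max_i \sum_v mp_expo P i v)%N.

(* The variables are x_j, indexed by [inl j], and d_j, indexed by [inr j]. *)
Definition bar_coord (R : realType) (n : nat) (t : n.-tuple (bar R))
    (v : 'I_n + 'I_n) : R :=
  match v with
  | inl j => bar_left (tnth t j)
  | inr j => bar_len (tnth t j)
  end.

Definition is_maxplus (R : realType) (n : nat) (P : maxplus R ('I_n + 'I_n)%type)
    (f : n.-tuple (bar R) -> R) : Prop :=
  forall t, f t = mp_eval P (bar_coord t).

(* f restricted to d_j = 0 does not depend on x_j *)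
Definition forgets_left (R : realType) (n : nat) (f : n.-tuple (bar R) -> R) :
    Prop :=
  forall (j : 'I_n) (t u : n.-tuple (bar R)),
    bar_len (tnth t j) = 0 -> bar_len (tnth u j) = 0 ->
    (forall i, i != j -> tnth t i = tnth u i) ->
    f t = f u.

Definition Dpoly (R : realType) (n : nat) : set (n.-tuple (bar R) -> R) :=
  [set f | (exists P, is_maxplus P f) /\ forgets_left f].

Definition Dsym (R : realType) (n : nat) : set (n.-tuple (bar R) -> R) :=
  [set f | @Dpoly R n f /\
    forall (s : 'S_n) (t : n.-tuple (bar R)),
      f [tuple tnth t (s i) | i < n] = f t].

(* All formal polynomials inducing f have the same degree: see
   [mp_degree_unique]. *)
Definition Dsym_le (R : realType) (k n : nat) : set (n.-tuple (bar R) -> R) :=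
  [set f | @Dsym R n f /\ exists2 P, is_maxplus P f & (mp_degree P <= k)%N].

Definition bar0 (R : realType) : bar R := (0%:nng, 0%:nng).

Definition restrict_last (R : realType) (n : nat)
    (f : n.+1.-tuple (bar R) -> R) : n.-tuple (bar R) -> R :=
  fun t => f [tuple of rcons t (bar0 R)].

Definition Dlim (R : realType) (k : nat) :
    set (forall n, n.-tuple (bar R) -> R) :=
  [set f | (forall n, @Dsym_le R k n (f n)) /\
           (forall n, restrict_last (f n.+1) = f n)].

Record barpoly (R : realType) := BarPoly {
  barpoly_seq : forall n, n.-tuple (bar R) -> R;
  barpolyP : (\bigcup_(k in [set k | (1 <= k)%N]) @Dlim R k) barpoly_seq }.

(* The value does not depend on the representative: see [barpoly_evalE]. *)
Definition barpoly_eval (R : realType) (F : barpoly R) (b : barcode R) : R :=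
  barpoly_seq F (in_tuple (repr b)).

Coercion barpoly_eval : barpoly >-> Funclass.

(** * Independence of the representatives *)

Lemma matchingP (A B : finType) (theta : {ffun A -> option B}) :
  reflect (forall a a' b, theta a = Some b -> theta a' = Some b -> a = a')
          (matching theta).
Proof.
apply: (iffP idP) => [/forallP th a a' b ab a'b|th].
  by move: (th a) => /forallP/(_ a'); rewrite ab a'b eqxx => /eqP.
apply/forallP => a; apply/forallP => a'; apply/implyP => /eqP aa'.
case ab: (theta a) => [b|] //=; apply/eqP/(th _ _ b) => //.
by rewrite -aa'.
Qed.

Lemma sum_split_inj (R : realType) (A A' : finType) (h : A' -> A)
    (P : pred A) (G : A -> R) : injective h ->
  \sum_(a | P a) G a =
  \sum_(a | P (h a)) G (h a) + \sum_(a | P a && (a \notin codom h)) G a.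
Proof.
move=> hI; rewrite (bigID (fun a => a \in codom h)) /=; congr (_ + _).
rewrite (reindex_omap h (fun a => [pick a' | h a' == a])) /=.
  apply: eq_bigl => a; rewrite codom_f andbT.
  case: pickP => [a' /eqP/hI ->|/(_ a)]; last by rewrite eqxx.
  by rewrite eqxx andbT.
move=> a /andP[_ /codomP[a' ->]].
by case: pickP => [a'' /eqP <- //|/(_ a')]; rewrite eqxx.
Qed.

Lemma bar_len_ge0 (R : realType) (I : bar R) : 0 <= bar_len I.
Proof. exact: (ge0 I.2). Qed.

Lemma dist_barC (R : realType) (I J : bar R) : dist_bar I J = dist_bar J I.
Proof.
rewrite /dist_bar distrC; congr Num.max.
by rewrite -normrN; congr `|_|; lra.
Qed.

Lemma dist_diag_le (R : realType) (I J : bar R) :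
  bar_len I = 0 -> dist_diag J <= dist_bar I J.
Proof.
move=> I0; rewrite /dist_diag /dist_bar I0 le_max.
have := bar_len_ge0 J.
set u := bar_left I - bar_left J; set d := bar_len J => d0.
have -> : 0 - d + bar_left I - bar_left J = u - d by rewrite /u; lra.
case: (lerP (d / 2) `|u|) => //= ud; rewrite ler_normr; apply/orP; right.
by have := ler_norm u; lra.
Qed.

Lemma wasserstein_fam_le (R : realType) (p : R) (A A' B B' : finType)
    (I : A -> bar R) (J : B -> bar R) (I' : A' -> bar R) (J' : B' -> bar R) :
  0 < p ->
  (forall theta, matching theta -> exists2 theta', matching theta' &
     matching_cost p I' J' theta' <= matching_cost p I J theta) ->
  wasserstein_fam p I' J' <= wasserstein_fam p I J.
Proof.
move=> p0 H; have cost_ge0 (C D : finType) (K : C -> bar R) (L : D -> bar R) th :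
    0 <= matching_cost p K L th.
  by rewrite /matching_cost !addr_ge0// sumr_ge0// => *;
    rewrite ?sumr_ge0// => *; exact: powR_ge0.
have H' theta : matching theta ->
    \big[Num.min/matching_cost p I' J' [ffun=> None]]_(th | matching th)
      matching_cost p I' J' th <= matching_cost p I J theta.
  by move=> /H[th mth]; exact: bigmin_inf.
rewrite /wasserstein_fam; apply: ge0_ler_powR.
- by rewrite invr_ge0 ltW.
- by rewrite nnegrE; apply: le_bigmin.
- by rewrite nnegrE; apply: le_bigmin.
apply: le_bigmin => // ; apply: H'.
by apply/matchingP => a a' b; rewrite ffunE.
Qed.

Lemma wasserstein_famC (R : realType) (p : R) (A B : finType)
    (I : A -> bar R) (J : B -> bar R) : 0 < p ->
  wasserstein_fam p I J = wasserstein_fam p J I.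
Proof.
move=> p0; apply/le_anti/andP.
suff le (C D : finType) (K : C -> bar R) (L : D -> bar R) :
  wasserstein_fam p K L <= wasserstein_fam p L K by split.
apply: wasserstein_fam_le => // theta /matchingP th.
pose tau := [ffun c : C => [pick d | theta d == Some c]].
have tauE d c : (tau c == Some d) = (theta d == Some c).
  rewrite ffunE; case: pickP => [d' /eqP d'c|/(_ d) -> //].
  apply/eqP/eqP => [[<-] //|dc]; congr Some; exact: th d'c dc.
have tau0 c : (tau c == None) = [forall d, theta d != Some c].
  apply/eqP/forallP => [tc d|dc]; first by rewrite -tauE tc.
  by rewrite ffunE; case: pickP => // d; rewrite (negbTE (dc d)).
exists tau.
  apply/matchingP => c c' d /eqP; rewrite tauE => /eqP dc /eqP.
  by rewrite tauE dc => /eqP[].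
rewrite /matching_cost le_eqVlt; apply/orP; left; apply/eqP.
rewrite -!addrA; congr (_ + _); last rewrite addrC; last congr (_ + _).
- rewrite (exchange_big_dep predT) //=; apply: eq_bigr => d _.
  apply: eq_big => [c|c _]; first by rewrite tauE.
  by rewrite dist_barC.
- apply: eq_bigl => d; apply/forallP/eqP => [td|td c].
    by case E: (theta d) => [c|] //; move: (td c); rewrite tauE E eqxx.
  by rewrite tauE td.
- exact: eq_bigl.
Qed.

Lemma wasserstein_fam_inj (R : realType) (p : R) (A A' B : finType)
    (I : A -> bar R) (I' : A' -> bar R) (J : B -> bar R) (h : A' -> A) :
  0 < p -> injective h -> (forall a, I' a = I (h a)) ->
  (forall a, a \notin codom h -> bar_len (I a) = 0) ->
  wasserstein_fam p I' J = wasserstein_fam p I J.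
Proof.
move=> p0 hI I'E I0; have pn0 : p != 0 by rewrite gt_eqF.
apply/le_anti/andP; split; apply: wasserstein_fam_le => // theta /matchingP th.
  exists [ffun a => theta (h a)].
    by apply/matchingP => a a' b; rewrite !ffunE => /th{}th /th/hI.
  rewrite /matching_cost [in leRHS](sum_split_inj _ _ hI).
  rewrite [X in _ <= _ + X + _](sum_split_inj _ _ hI).
  rewrite -!addrA; apply: lerD.
    by apply: ler_sum => a _; rewrite ffunE I'E.
  rewrite addrCA; apply: lerD.
    by under eq_bigl do rewrite ffunE; under eq_bigr do rewrite I'E.
  rewrite addrCA -[leLHS]add0r; apply: lerD.
    by apply: sumr_ge0 => *; exact: powR_ge0.
  rewrite (exchange_big_dep predT) //= [X in _ + X]big_mkcond /= -big_split /=.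
  rewrite big_mkcond /=; apply: ler_sum => b _.
  have sum_ge0 : 0 <= \sum_(i | (i \notin codom h) && (theta i == Some b))
      dist_bar (I i) (J b) `^ p.
    by apply: sumr_ge0 => *; exact: powR_ge0.
  case: ifPn => [/forallP nb|_]; last first.
    by rewrite addr_ge0//; case: ifP => // _; exact: powR_ge0.
  case: ifPn => [_|]; first by rewrite lerDr.
  rewrite negb_forall => /existsP[a]; rewrite negbK => ab.
  have ah : a \notin codom h.
    by apply/codomP => -[a' E]; move: (nb a'); rewrite ffunE -E ab.
  rewrite addr0 (bigD1 a) ?ah//= ler_wpDr//.
    by apply: sumr_ge0 => *; exact: powR_ge0.
  apply: ge0_ler_powR; rewrite ?nnegrE.
  - exact: ltW.
  - by rewrite divr_ge0// bar_len_ge0.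
  - by rewrite le_max normr_ge0.
  - by apply: dist_diag_le; exact: I0.
pose pinv a := [pick a' | h a' == a].
have pinvE a' : pinv (h a') = Some a'.
  by rewrite /pinv; case: pickP => [a /eqP/hI -> //|/(_ a')]; rewrite eqxx.
have pinv0 a : a \notin codom h -> pinv a = None.
  move=> ah; rewrite /pinv; case: pickP => // a' /eqP E.
  by rewrite -E codom_f in ah.
pose tau := [ffun a => obind theta (pinv a)].
have tauE a' : tau (h a') = theta a' by rewrite ffunE pinvE.
have tau0 a : a \notin codom h -> tau a = None.
  by move=> ah; rewrite ffunE pinv0.
exists tau.
  apply/matchingP => a1 a2 b; have [/codomP[c1 ->]|/tau0 -> //] := boolP (a1 \in codom h).
  have [/codomP[c2 ->]|/tau0 -> //] := boolP (a2 \in codom h).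
  by rewrite !tauE => /th{}th /th ->.
rewrite /matching_cost [in leLHS](sum_split_inj _ _ hI).
rewrite [X in _ + X + _ <= _](sum_split_inj _ _ hI).
rewrite [X in _ + X + _ + _ <= _]big1 ?addr0; last first.
  by move=> a /tau0 ->; rewrite big_pred0.
rewrite [X in _ + (_ + X) + _ <= _]big1 ?addr0; last first.
  by move=> a /andP[_ ah]; rewrite /dist_diag I0// mul0r powR0.
rewrite le_eqVlt; apply/orP; left; apply/eqP; congr (_ + _ + _).
- by apply: eq_bigr => a _; rewrite tauE I'E.
- by apply: eq_big => [a|a _]; rewrite ?tauE ?I'E.
- apply: eq_bigl => b; apply/forallP/forallP => tb a; first by rewrite -tauE.
  by have [/codomP[c ->]|/tau0 -> //] := boolP (a \in codom h); rewrite tauE.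
Qed.

Lemma perm_eq_tnth (T : eqType) (s t : seq T) : perm_eq s t ->
  exists2 h : 'I_(size s) -> 'I_(size t), bijective h &
    forall i, tnth (in_tuple s) i = tnth (in_tuple t) (h i).
Proof.
move=> st; have sz := perm_size st.
have /tuple_permP[q E] : perm_eq s (tcast (esym sz) (in_tuple t)).
  by rewrite val_tcast.
exists (fun i => cast_ord sz (q i)).
  apply: bij_comp; last exact: injF_bij perm_inj.
  by exists (cast_ord (esym sz)) => i; apply/val_inj.
move=> i; set u := tcast _ _ in E.
have -> : in_tuple s = [tuple tnth u (q i) | i < size s] by exact: val_inj.
by rewrite tnth_mktuple tcastE; congr tnth; apply/val_inj.
Qed.

Lemma wasserstein_fam_equiv (R : realType) (p : R) (B : finType)
    (s t : seq (bar R)) (J : B -> bar R) : 0 < p -> bar_equiv s t ->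
  wasserstein_fam p (tnth (in_tuple s)) J =
  wasserstein_fam p (tnth (in_tuple t)) J.
Proof.
move=> p0 /asboolP; elim=> {s t} [s t st|//|s t _ -> //|s u t _ -> _ -> //].
case: st => {s t} [s t /perm_eq_tnth[h hB hE]|s I I0].
  apply: (wasserstein_fam_inj _ p0 (bij_inj hB) hE) => a.
  by case: hB => g _ gK; rewrite -(gK a) codom_f.
have sz : (size s <= size (rcons s I))%N by rewrite size_rcons.
apply/esym/(@wasserstein_fam_inj _ _ _ _ _ _ _ _ (widen_ord sz)) => //.
- by move=> i j /(congr1 val)/= ij; apply/val_inj.
- move=> i; rewrite !(tnth_nth I) /= nth_rcons.
  by rewrite ltn_ord.
move=> i ih; rewrite (tnth_nth I) /= nth_rcons.
case: ltnP => [lt|]; last by rewrite if_same.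
case/negP: ih; apply/codomP; exists (Ordinal lt); exact/val_inj.
Qed.

Lemma bar_equiv_repr (R : realType) (s : seq (bar R)) :
  bar_equiv (repr (\pi_(barcode R) s)) s.
Proof. by apply/(@eqmodP _ (bar_equiv_rel R)); rewrite reprK. Qed.

Lemma wassersteinE (R : realType) (p : R) (s t : seq (bar R)) : 0 < p ->
  wasserstein p (\pi_(barcode R) s) (\pi_(barcode R) t) =
  wasserstein_fam p (tnth (in_tuple s)) (tnth (in_tuple t)).
Proof.
move=> p0; rewrite /wasserstein (wasserstein_fam_equiv _ p0 (bar_equiv_repr s)).
rewrite wasserstein_famC// (wasserstein_fam_equiv _ p0 (bar_equiv_repr t)).
exact: wasserstein_famC.
Qed.

Lemma barpoly_evalE (R : realType) (F : barpoly R) (s : seq (bar R)) :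
  F (\pi_(barcode R) s) = barpoly_seq F (in_tuple s).
Proof.
rewrite /barpoly_eval; case: F => f /= [k _ [fD flim]].
have castE n (t : n.-tuple (bar R)) : f n t = f _ (in_tuple t).
  case: t => t tn; have e := eqP tn; case: n / e tn => tn.
  by congr (f _ _); exact/val_inj.
have seqE (u v : seq (bar R)) : u = v -> f _ (in_tuple u) = f _ (in_tuple v).
  by move=> ->.
have := bar_equiv_repr s; move: (repr _) => t /asboolP.
elim=> {s t} [s t st|//|s t _ -> //|s u t _ -> _ -> //].
case: st => {s t} [s t st|s I I0].
  have /tuple_permP[q E] : perm_eq s (in_tuple t) by [].
  have [[_ fS] _] := fD (size t).
  by rewrite -(fS q) [RHS]castE; exact: seqE.
have [[[_ fl] _] _] := fD (size s).+1.
have -> : f _ (in_tuple (rcons s I)) = f _ [tuple of rcons (in_tuple s) I].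
  by rewrite [RHS]castE; exact: seqE.
transitivity (restrict_last (f (size s).+1) (in_tuple s)); last by rewrite flim.
rewrite /restrict_last.
have lastE (K : bar R) :
    tnth [tuple of rcons (in_tuple s) K] ord_max = K.
  by rewrite (tnth_nth K) /= nth_rcons ltnn eqxx.
apply: (fl ord_max); rewrite ?lastE// => i.
rewrite -val_eqE /= => im; rewrite !(tnth_nth I) /= !nth_rcons.
by rewrite ltn_neqAle im -ltnS ltn_ord.
Qed.

Lemma mp_degree_unique (R : realType) (n : nat)
    (P Q : maxplus R ('I_n + 'I_n)%type) (f : n.-tuple (bar R) -> R) :
  is_maxplus P f -> is_maxplus Q f -> mp_degree P = mp_degree Q.
Proof.
suff le P' Q' : is_maxplus P' f -> is_maxplus Q' f ->
    (mp_degree P' <= mp_degree Q')%N.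
  by move=> Pf Qf; apply/eqP; rewrite eqn_leq !le.
move: P' Q' => {}P {}Q Pf Qf.
rewrite leqNgt; apply/negP => QP.
have [i degP] : {i | mp_degree P = (\sum_v mp_expo P i v)%N}.
  by apply: bigop.eq_bigmax; rewrite card_ord.
pose M := \big[Num.max/mp_coef Q ord0]_j mp_coef Q j.
pose r := `|M - mp_coef P i| + 1.
have r0 : 0 <= r by rewrite addr_ge0.
pose t := [tuple ((NngNum r0, NngNum r0) : bar R) | _ < n].
have cE v : bar_coord t v = r by case: v => j; rewrite /= tnth_mktuple.
have monE (T : maxplus R ('I_n + 'I_n)%type) k : mp_monomial T (bar_coord t) k =
    mp_coef T k + (\sum_v mp_expo T k v)%:R * r.
  rewrite /mp_monomial natr_sum mulr_suml; congr (_ + _).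
  by apply: eq_bigr => v _; rewrite cE.
have lo : mp_coef P i + (mp_degree P)%:R * r <= f t.
  by rewrite Pf degP -monE; exact: le_bigmax.
have mon_le k : mp_monomial Q (bar_coord t) k <= M + (mp_degree Q)%:R * r.
  rewrite monE; apply: lerD; first exact: le_bigmax.
  rewrite ler_wpM2r// ler_nat; exact: (leq_bigmax (F := fun k => \sum_v _)%N).
have hi : f t <= M + (mp_degree Q)%:R * r by rewrite Qf; exact: bigmax_le.
have : (mp_degree Q)%:R * r + r <= (mp_degree P)%:R * r.
  by rewrite -[X in _ + X]mul1r -mulrDl natr1 ler_wpM2r// ler_nat.
have : M - mp_coef P i < r by rewrite ltr_pwDr// ler_norm.
by lra.
Qed.

(* Main.v *)
Require Import Defs.
From mathcomp Require Import all_boot all_order all_algebra reals.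
From Stdlib Require Import Relation_Operators.
From mathcomp Require Import generic_quotient interval_inference.
From mathcomp Require Import boolp exp lra.

Import Order.TTheory GRing.Theory Num.Theory.

Local Open Scope ring_scope.

(** After padding both barcodes with bars of length 0, placed at the midpoints
    of the unmatched bars, a matching becomes a bijection between two families
    of n bars in which the p-th powers of the distances sum to at most its cost
    c.  Hence every single distance is at most c^(1/p).  A monomial of degree at
    most k has at most k factors, so moving every coordinate by at most e
    changes it, and a maximum of such monomials, by at most k e: the constant
    does not depend on n. *)

Lemma mp_eval_lip (R : realType) (V : finType) (P : maxplus R V)
    (z w : V -> R) (e : R) (k : nat) :
  0 <= e -> (mp_degree P <= k)%N -> (forall v, `|z v - w v| <= e) ->
  `|mp_eval P z - mp_eval P w| <= k%:R * e.
Proof.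
move=> e0 Pk zw.
have le (x y : V -> R) : (forall v, `|x v - y v| <= e) ->
    mp_eval P x <= mp_eval P y + k%:R * e.
  move=> xy; have mon i : mp_monomial P x i <= mp_eval P y + k%:R * e.
    apply: (@le_trans _ _ (mp_monomial P y i + k%:R * e)); last first.
      by rewrite lerD2r; exact: le_bigmax.
    rewrite /mp_monomial -addrA lerD2l -lerBlDl -sumrB.
    apply: (@le_trans _ _ (\sum_v (mp_expo P i v)%:R * e)).
      apply: ler_sum => v _; rewrite -mulrBr ler_wpM2l//.
      exact: le_trans (ler_norm _) (xy v).
    rewrite -mulr_suml -natr_sum ler_wpM2r// ler_nat.
    apply: leq_trans Pk.
    exact: (leq_bigmax (F := fun k => \sum_v mp_expo P k v)%N).
  exact: bigmax_le.
have wz v : `|w v - z v| <= e by rewrite distrC.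
by have := le z w zw; have := le w z wz; rewrite ler_norml; lra.
Qed.

(** [dist_bar] controls both endpoints; a length is a difference of endpoints, which accounts for
    the factor 2. *)
Lemma bar_coord_dist (R : realType) (n : nat) (t u : n.-tuple (bar R)) (e : R) v :
  (forall i, dist_bar (tnth t i) (tnth u i) <= e) ->
  `|bar_coord t v - bar_coord u v| <= 2 * e.
Proof.
move=> tu.
case: v => i /=; move: (tu i); rewrite /dist_bar ge_max !ler_norml; lra.
Qed.

Lemma barpoly_tuple (R : realType) (F : barpoly R) (n : nat)
    (t : n.-tuple (bar R)) :
  F (\pi_(barcode R)%qT (tval t)) = barpoly_seq F t.
Proof.
rewrite barpoly_evalE; case: t => t tn; have e := eqP tn.
by case: n / e tn => tn; congr (barpoly_seq F _); exact/val_inj.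
Qed.

(** All components of [F] share one degree bound, so the constant can be fixed before the index type
    [C], whatever its cardinality. *)
Lemma barpoly_family_lip (R : realType) (F : barpoly R) :
  exists k : R, forall (C : finType) (K L : C -> bar R) (e : R),
    0 <= e -> (forall c, dist_bar (K c) (L c) <= e) ->
    `|F (\pi_(barcode R)%qT (codom K)) - F (\pi_(barcode R)%qT (codom L))|
      <= k * e.
Proof.
have [k _ [Fk _]] := barpolyP F.
exists (k%:R * 2) => C K L e e0 KL; have [_ [P PF Pk]] := Fk #|C|.
rewrite !(barpoly_tuple _ F _ (codom_tuple _)) !PF -mulrA.
apply: mp_eval_lip => // [|v]; first by rewrite mulr_ge0.
by apply: bar_coord_dist => i; rewrite !tnth_map.
Qed.

Lemma bar_equiv_cat0 (R : realType) (s t : seq (bar R)) :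
  all (fun I => bar_len I == 0) t -> bar_equiv (s ++ t) s.
Proof.
elim/last_ind: t => [|t I IH]; first by rewrite cats0 bar_equiv_refl.
rewrite all_rcons -rcons_cat => /andP[/eqP I0 /IH].
by apply: bar_equiv_trans; apply/asboolP/rst_step/BarDrop.
Qed.

Lemma bar_equiv_codom (R : realType) (A A' : finType) (I : A -> bar R)
    (I' : A' -> bar R) (h : A' -> A) :
  injective h -> (forall a, I' a = I (h a)) ->
  (forall a, a \notin codom h -> bar_len (I a) = 0) ->
  bar_equiv (codom I) (codom I').
Proof.
move=> hI I'E I0.
pose r := [seq a <- enum A | a \notin codom h].
have rE : perm_eq (enum A) (codom h ++ r).
  apply: uniq_perm; first exact: enum_uniq.
    rewrite cat_uniq filter_uniq ?enum_uniq// andbT.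
    apply/andP; split; first exact/injectiveP.
    by apply/hasPn => a; rewrite mem_filter => /andP[].
  by move=> a; rewrite mem_enum mem_cat [a \in r]mem_filter mem_enum andbT orbN.
have -> : codom I' = [seq I a | a <- codom h].
  by rewrite /codom /image_mem -map_comp; apply: eq_map => a /=; rewrite I'E.
apply: (@bar_equiv_trans _ ([seq I a | a <- codom h] ++ [seq I a | a <- r])).
  by rewrite -map_cat; apply/asboolP/rst_step/BarPerm/perm_map.
apply: bar_equiv_cat0; apply/allP => _ /mapP[a + ->].
by rewrite mem_filter => /andP[ah _]; apply/eqP/I0.
Qed.

(** A point of the diagonal nearest to [I]: collapsing [I] to its midpoint moves each endpoint by
    half its length. *)
Definition midbar (R : realType) (I : bar R) : bar R :=
  ((I.1%:num + I.2%:num / 2)%:nng, 0%:nng).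

Lemma dist_midbar (R : realType) (I : bar R) :
  dist_bar I (midbar R I) = dist_diag I.
Proof.
rewrite /dist_bar /dist_diag /midbar /bar_left /bar_len /=.
have d0 : 0 <= I.2%:num :> R by [].
set x := I.1%:num; set d := I.2%:num in d0 *.
have -> : x - (x + d / 2) = - (d / 2) by lra.
have -> : d - 0 + x - (x + d / 2) = d / 2 by lra.
by rewrite normrN maxxx ger0_norm// divr_ge0.
Qed.

Lemma dist_bar_ge0 (R : realType) (I J : bar R) : 0 <= dist_bar I J.
Proof. by rewrite le_max normr_ge0. Qed.

Lemma dist_barxx (R : realType) (I : bar R) : dist_bar I I = 0.
Proof. by rewrite /dist_bar -addrA !subrr normr0 addr0 normr0 maxxx. Qed.

Lemma le_powRV (R : realType) (p x y : R) :
  0 < p -> 0 <= x -> x `^ p <= y -> x <= y `^ p^-1.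
Proof.
move=> p0 x0 xy; rewrite -[x]powRr1// -(@mulfV _ p) ?gt_eqF// powRrM.
apply: ge0_ler_powR; rewrite ?nnegrE ?invr_ge0 ?powR_ge0 ?(ltW p0)//.
exact: le_trans (powR_ge0 _ _) xy.
Qed.

(** Index [inl a] pairs [I a] with its partner or its midpoint; [inr b] pairs an unmatched [J b]
    with its midpoint. A matched [J b] already occurs at an [inl] index, so [inr b] then carries the
    same zero-length bar on both sides. *)
Lemma matching_pad (R : realType) (p : R) (A B : finType) (I : A -> bar R)
    (J : B -> bar R) (theta : {ffun A -> option B}) :
  0 < p -> matching theta ->
  exists (C : finType) (K L : C -> bar R),
    [/\ bar_equiv (codom K) (codom I), bar_equiv (codom L) (codom J) &
     forall c, dist_bar (K c) (L c) <= matching_cost p I J theta `^ p^-1].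
Proof.
move=> p0 /matchingP th.
(* The partial inverse of [theta], single-valued because [theta] is a matching. *)
pose g b := [pick a | theta a == Some b].
pose K (c : A + B) := match c with inl a => I a | inr b => midbar R (J b) end.
pose L (c : A + B) := match c with
  | inl a => if theta a is Some b then J b else midbar R (I a)
  | inr b => if g b is Some _ then midbar R (J b) else J b end.
(* The position of [J b] in [L]; all other positions of [L] hold midpoints. *)
pose h b : A + B := if g b is Some a then inl a else inr b.
have gP a b : (g b == Some a) = (theta a == Some b).
  rewrite /g; case: pickP => [a' /eqP a'b|/(_ a) -> //].
  by apply/eqP/eqP => [[<-] //|ab]; congr Some; exact: th a'b ab.
exists (A + B)%type, K, L; split.
- apply: (bar_equiv_codom _ _ _ _ _ inl) => // [a a' []//|[a|b]//].
  by rewrite codom_f.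
- apply: (bar_equiv_codom _ _ _ _ _ h).
  + move=> b b'; rewrite /h; case gb: (g b) => [a|]; case gb': (g b') => [a'|] //.
      move=> [aa']; move/eqP: gb; rewrite aa' gP => /eqP ab.
      by move/eqP: gb'; rewrite gP ab => /eqP[].
    by case.
  + move=> b; rewrite /h; case gb: (g b) => [a|] /=; last by rewrite gb.
    by move/eqP: gb; rewrite gP => /eqP ->.
  + move=> [a|b] /= nh.
      case ab: (theta a) => [b|] //; case/negP: nh; apply/codomP; exists b.
      by move/eqP: ab; rewrite -gP /h => /eqP ->.
    case gb: (g b) => [a|] //; case/negP: nh; apply/codomP; exists b.
    by rewrite /h gb.
(* All terms of the cost are nonnegative, so the cost dominates each of them. *)
have S0 (D : finType) (Q : pred D) (G : D -> R) :
  0 <= \sum_(i | Q i) G i `^ p by apply: sumr_ge0 => *; exact: powR_ge0.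
have SS0 (D E : finType) (Q : D -> pred E) (G : D -> E -> R) :
  0 <= \sum_i \sum_(j | Q i j) G i j `^ p by exact: sumr_ge0.
have S1 (D : finType) (Q : pred D) (G : D -> R) i : Q i ->
    G i `^ p <= \sum_(i | Q i) G i `^ p.
  by move=> Qi; rewrite (bigD1 i)//= lerDl.
move=> [a|b] /=.
  case ab: (theta a) => [b|]; apply: le_powRV; rewrite ?dist_bar_ge0//.
    rewrite /matching_cost -addrA ler_wpDr ?addr_ge0//.
    rewrite (bigD1 a)//= ler_wpDr//; first exact: sumr_ge0.
    by apply: (S1 _ _ (fun b => dist_bar (I a) (J b))); rewrite ab.
  rewrite dist_midbar /matching_cost ler_wpDr// ler_wpDl//.
  by apply: (S1 _ _ (fun a => dist_diag (I a))); rewrite ab.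
case gb: (g b) => [a|]; first by rewrite dist_barxx powR_ge0.
apply: le_powRV; rewrite ?dist_bar_ge0// dist_barC dist_midbar.
rewrite /matching_cost ler_wpDl ?addr_ge0//.
apply: (S1 _ _ (fun b => dist_diag (J b))).
by apply/forallP => a; rewrite -gP gb.
Qed.

(** A binary minimum is one of its arguments, and the initial value is itself the cost of a
    matching, so being the cost of a matching passes through the iteration. *)
Lemma wasserstein_attained (R : realType) (p : R) (A B : finType)
    (I : A -> bar R) (J : B -> bar R) :
  exists2 theta, matching theta &
    wasserstein_fam p I J = matching_cost p I J theta `^ p^-1.
Proof.
suff [th mth E] : exists2 th, matching th &
    \big[Num.min/matching_cost p I J [ffun=> None]]_(th | matching th)
      matching_cost p I J th = matching_cost p I J th.
  by exists th; rewrite // /wasserstein_fam E.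
apply: (big_ind (fun c => exists2 th, matching th &
  c = matching_cost p I J th)) => [|x y [th mth ->] [th' mth' ->]|th mth].
- by exists [ffun=> None] => //; apply/matchingP => a a' b; rewrite ffunE.
- by case: leP => _; [exists th | exists th'].
- by exists th.
Qed.

Lemma codom_tnth_in_tuple (T : Type) (s : seq T) : codom (tnth (in_tuple s)) = s.
Proof. by rewrite /codom /image_mem -[RHS](map_tnth_enum (in_tuple s)). Qed.

Theorem theorem5p4 (R : realType) (F : barpoly R) (p : R) (hp : 1 <= p) :
  exists C : R, forall b1 b2 : barcode R,
    `|F b1 - F b2| <= C * wasserstein p b1 b2.
Proof.
have p0 : 0 < p by exact: lt_le_trans hp.
have [k Fk] := barpoly_family_lip _ F.
exists k => b1 b2; rewrite /wasserstein.
have [th mth ->] := wasserstein_attained _ p _ _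
  (tnth (in_tuple (repr b1))) (tnth (in_tuple (repr b2))).
have [C [K [L [K1 L2 KL]]]] := matching_pad _ _ _ _
  (tnth (in_tuple (repr b1))) (tnth (in_tuple (repr b2))) _ p0 mth.
(* Padding does not change the class in the quotient. *)
have piE (M : C -> bar R) b : bar_equiv (codom M) (codom (tnth (in_tuple (repr b)))) ->
    b = \pi_(barcode R)%qT (codom M).
  rewrite codom_tnth_in_tuple => Mb; rewrite -[LHS]reprK.
  by apply/esym/(@eqmodP _ (bar_equiv_rel R)).
(* Only the arguments of [F] are replaced; the cost on the right keeps the original
   representatives. *)
rewrite {1}(piE K b1)// {1}(piE L b2)//.
by apply: Fk => //; exact: powR_ge0.
Qed.
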